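(* Let $F$ be a field of characteristic zero and let $\alpha \in F\setminus\{0\}$. The trace $T$-ideal $\mathrm{Id}^{tr}(D_2^{t_{\alpha,0}})$ is generated, as a trace $T$-ideal, by the polynomials $$f_1=[x_1,x_2],\qquad f_2=\mathrm{Tr}(x_1)\mathrm{Tr}(x_2)-\alpha\,\mathrm{Tr}(x_1x_2).$$ Moreover, $c_n^{tr}(D_2^{t_{\alpha,0}})=2^n$ (for every $n\ge 1$).
   Context: $F$ is a field of characteristic 0. An algebra with trace is a unitary associative $F$-algebra $A$ with an $F$-linear map $\mathrm{tr}:A\to F$ such that $\mathrm{tr}(ab)=\mathrm{tr}(ba)$; a scalar $\alpha\in F$ is identified with $\alpha\cdot 1_A$. The free algebra with trace $F\langle X,\mathrm{Tr}\rangle\cong F\langle X\rangle\otimes F[\mathrm{Tr}(M)]$ on $X=\{x_1,x_2,\dots\}$ is generated by the free unitary associative algebra $F\langle X\rangle$ and central commuting indeterminates $\mathrm{Tr}(M)$, $M$ a nonempty word in $X$, subject to $\mathrm{Tr}(MN)=\mathrm{Tr}(NM)$ and $\mathrm{Tr}(\mathrm{Tr}(M)N)=\mathrm{Tr}(M)\mathrm{Tr}(N)$. An element $f$ is a trace identity of $A$ if it becomes $0$ whenever the variables $x_i$ are replaced by arbitrary elements of $A$ and $\mathrm{Tr}$ by $\mathrm{tr}$; $\mathrm{Id}^{tr}(A)$ is the set of trace identities of $A$. A trace $T$-ideal is an ideal of $F\langle X,\mathrm{Tr}\rangle$ invariant under all endomorphisms of the free algebra with trace, i.e. under all substitutions $x_i\mapsto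 g_i$ (performed also inside $\mathrm{Tr}$), where $g_i$ is a linear combination of products of a (possibly empty) product of traces with a nonempty word. The trace $T$-ideal generated by a set is the smallest one containing it. $MT_n$ is the space of multilinear elements of $F\langle X,\mathrm{Tr}\rangle$ in $x_1,\dots,x_n$, i.e. the span of all $\mathrm{Tr}(x_{i_1}\cdots x_{i_a})\cdots \mathrm{Tr}(x_{j_1}\cdots x_{j_b})x_{l_1}\cdots x_{l_c}$ in which each of $x_1,\dots,x_n$ occurs exactly once (possibly no traces, possibly no letters outside traces). $c_n^{tr}(A)=\dim_F MT_n/(MT_n\cap \mathrm{Id}^{tr}(A))$. $[a,b]=ab-ba$. $D_2$ is the algebra of $2\times2$ diagonal matrices over $F$, and $D_2^{t_{\alpha,\beta}}$ is $D_2$ with the trace $t_{\alpha,\beta}(\mathrm{diag}(a,b))=\alpha a+\beta b$. *)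

(* Defs.v *)
From HB Require Import structures.
From mathcomp Require Import all_boot all_order all_algebra.
From mathcomp Require Import finmap monalg ring.

Set Implicit Arguments.
Unset Strict Implicit.
Unset Printing Implicit Defensive.

Import GRing.Theory.

Local Open Scope ring_scope.
Local Open Scope quotient_scope.

(* Variables are indexed by nat from 0: [i : nat] stands for x_{i+1}.         *)
Definition nword : Type := {s : seq nat | s != [::]}.

HB.instance Definition _ := Choice.on nword.

Definition rotation (u v : nword) : bool :=
  val v \in [seq rot k (val u) | k <- iota 0 (size (val u))].

Lemma rotationP (u v : nword) :
  reflect (exists k, val v = rot k (val u)) (rotation u v).
Proof.
apply: (iffP mapP) => [[k _ ->]|[k ->]]; first by exists k.
case: (ltnP k (size (val u))) => [lt_k|le_k].
  by exists k => //; rewrite mem_iota.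
exists 0; last by rewrite rot0 rot_oversize.
by rewrite mem_iota /= add0n lt0n size_eq0 (valP u).
Qed.

Lemma rotation_equiv : equiv_class_of rotation.
Proof.
split=> [u|u v|v u w].
- by apply/rotationP; exists 0; rewrite rot0.
- apply/rotationP/rotationP => -[k ->].
    by exists (size (val u) - k)%N; rewrite -{1}(rotK k (val u)) /rotr size_rot.
  by exists (size (val v) - k)%N; rewrite -{1}(rotK k (val v)) /rotr size_rot.
move=> /rotationP[k vE] /rotationP[l wE]; apply/rotationP.
rewrite wE vE; case: (leqP k (size (val u))) => [le_k|/ltnW le_k]; last first.
  by exists l; rewrite (rot_oversize le_k).
case: (leqP l (size (val u))) => [le_l|/ltnW le_l]; last first.
  by exists k; rewrite [LHS]rot_oversize // size_rot.
by rewrite rot_add_mod //; eexists.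
Qed.

Canonical rotation_equivRel := EquivRelPack rotation_equiv.

(* The classes index the indeterminates Tr(M), with Tr(MN) = Tr(NM).          *)
Definition cword : Type := {eq_quot rotation}.

HB.instance Definition _ := Choice.on cword.
HB.instance Definition _ := EqQuotient.on cword.

(* (t, w) stands for t * w, with t a product of traces and w a word.          *)
Definition tmonom : Type := ({cmonom cword} * {fmonom nat})%type.

HB.instance Definition _ := Choice.on tmonom.

Definition tmon (t : {cmonom cword}) (w : {fmonom nat}) : tmonom := (t, w).

Definition tmone : tmonom := tmon mone mone.
Definition tmmul (m1 m2 : tmonom) : tmonom :=
  tmon (mmul m1.1 m2.1) (mmul m1.2 m2.2).

Fact tmmulA : associative tmmul.
Proof. by move=> x y z; rewrite /tmmul /tmon /= !mulmA. Qed.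
Fact tmmul1m : left_id tmone tmmul.
Proof. by case=> x y; rewrite /tmmul /tmone /tmon /= !mul1m. Qed.
Fact tmmulm1 : right_id tmone tmmul.
Proof. by case=> x y; rewrite /tmmul /tmone /tmon /= !mulm1. Qed.
Fact tmunit (x y : tmonom) : tmmul x y = tmone -> x = tmone /\ y = tmone.
Proof.
by case: x y => [x1 x2] [y1 y2] [] /unitm[-> ->] /unitm[-> ->].
Qed.

HB.instance Definition _ :=
  Choice_isMonomialDef.Build tmonom tmmulA tmmul1m tmmulm1 tmunit.

Fact malg_scalerAr (K : monomType) (R : comNzRingType) (c : R)
    (f g : {malg R[K]}) : c *: (f * g) = f * (c *: g).
Proof.
apply/malgP => m; rewrite mcoeffZ mcoeffMl.
rewrite (mcoeffMlw _ (fsubset_refl _) (msuppZ_le c g)).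
rewrite mulr_sumr; apply: eq_bigr => k1 _.
rewrite mulr_sumr; apply: eq_bigr => k2 _.
by rewrite mcoeffZ mulrnAr mulrCA.
Qed.

(* F<X, Tr> = F[Tr(M)] (x) F<X>, as the algebra of a product monoid.          *)
Definition ftr (F : fieldType) : Type := {malg F[tmonom]}.

Section FreeTraceAlgebra.
Variable F : fieldType.

HB.instance Definition _ := GRing.Lalgebra.on (ftr F).
HB.instance Definition _ := GRing.Lalgebra_isAlgebra.Build F (ftr F)
  (@malg_scalerAr tmonom F).

Definition ftr_var (i : nat) : ftr F := << tmon mone (fmu i) >>.

Definition ftr_word (w : seq nat) : ftr F := \prod_(i <- w) ftr_var i.

(* Tr (t * w) = t * Tr(w) for a nonempty word w. There is no indeterminate    *)
(* Tr(1): the terms with empty word part are sent to 0 (a junk value, never   *)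
(* reached below, where Tr is applied only to combinations of terms with      *)
(* nonempty word part).                                                       *)
Definition Tr (f : ftr F) : ftr F :=
  \sum_(m <- msupp f)
    if insub (fmonom_val m.2) is Some u
    then << f@_m *g tmon (mmul m.1 (ucm (\pi_cword u))) mone >> else 0.

(* Replaces x_i by a i and Tr by T. The values of T are meant to be central   *)
(* and T (b b') = T (b' b), so that neither the order of the factors nor the  *)
(* representative of the cyclic word matters.                                 *)
Definition tsubst (B : algType F) (T : B -> B) (a : nat -> B) (f : ftr F) : B :=
  \sum_(m <- msupp f) f@_m *:
    ((\prod_(c <- finsupp (cmonom_val m.1))
        T (\prod_(i <- val (repr c)) a i) ^+ m.1 c)
     * \prod_(i <- fmonom_val m.2) a i).

Record trace (A : algType F) := Trace {
  tr_fun :> {scalar A};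
  _ : forall a b : A, tr_fun (a * b) = tr_fun (b * a)
}.

Definition trace_id (A : algType F) (tr : trace A) (f : ftr F) : Prop :=
  forall a : nat -> A, tsubst (fun b => (tr b)%:A) a f = 0.

Definition no_empty_word (g : ftr F) : Prop :=
  forall m, m \in msupp g -> fmonom_val m.2 != [::].

Definition trace_Tideal (I : ftr F -> Prop) : Prop :=
  [/\ I 0,
      forall f g, I f -> I g -> I (f + g),
      forall f g h, I f -> I (g * f * h)
    & forall (s : nat -> ftr F) f, (forall i, no_empty_word (s i)) ->
        I f -> I (tsubst Tr s f)].

Definition generated_Tideal (S : ftr F -> Prop) (f : ftr F) : Prop :=
  forall I, trace_Tideal I -> (forall g, S g -> I g) -> I f.

Definition lspan (V : lmodType F) (S : V -> Prop) (v : V) : Prop :=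
  exists2 s : seq (F * V), (forall p, p \in s -> S p.2)
    & v = \sum_(p <- s) p.1 *: p.2.

(* The images of the b i form a basis of U / W, for a subspace W of U.        *)
Definition quotient_dim (V : lmodType F) (U W : V -> Prop) (d : nat) : Prop :=
  exists b : 'I_d -> V,
    [/\ forall i, U (b i),
        forall c : 'I_d -> F,
          W (\sum_(i < d) c i *: b i) -> forall i, c i = 0
      & forall v, U v -> exists c : 'I_d -> F, W (v - \sum_(i < d) c i *: b i)].

Definition multilinear_monomial (n : nat) (f : ftr F) : Prop :=
  exists (us : seq (seq nat)) (w : seq nat),
    [/\ [::] \notin us, perm_eq (flatten us ++ w) (iota 0 n)
      & f = (\prod_(u <- us) Tr (ftr_word u)) * ftr_word w].

Definition MT (n : nat) : ftr F -> Prop := lspan (multilinear_monomial n).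

(* c_n^tr = d                                                                 *)
Definition trace_codim (A : algType F) (tr : trace A) (n d : nat) : Prop :=
  quotient_dim (MT n) (fun f => MT n f /\ trace_id tr f) d.

Definition f1 : ftr F := ftr_var 0 * ftr_var 1 - ftr_var 1 * ftr_var 0.

Definition f2 (alpha : F) : ftr F :=
  Tr (ftr_var 0) * Tr (ftr_var 1) - alpha *: Tr (ftr_var 0 * ftr_var 1).

End FreeTraceAlgebra.

Section DiagonalMatrices.
Variable F : fieldType.

Definition diag2 : {pred 'M[F]_2} := [pred M | is_diag_mx M].

Fact diag2_subalg : subalg_closed diag2.
Proof.
split=> [|c M N|M N]; rewrite !inE.
- exact: (scalar_mx_is_diag _ (1 : F)).
- move=> /is_diag_mxP dM /is_diag_mxP dN; apply/is_diag_mxP => i j ij.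
  by rewrite !mxE dM // dN // mulr0 addr0.
move=> /is_diag_mxP dM /is_diag_mxP dN; apply/is_diag_mxP => i j ij.
rewrite mxE big1 // => k _; have [ik|ik] := eqVneq i k.
  by rewrite dN ?mulr0 // -ik.
by rewrite dM ?mul0r.
Qed.

HB.instance Definition _ := GRing.isSubalgClosed.Build F 'M[F]_2 diag2
  diag2_subalg.

Record D2 : Type := MkD2 { D2_val :> 'M[F]_2; _ : D2_val \in diag2 }.

HB.instance Definition _ := [isSub for D2_val].
HB.instance Definition _ := [Choice of D2 by <:].
HB.instance Definition _ := [SubChoice_isSubAlgebra of D2 by <:].

Variables alpha beta : F.

Definition diag_tr (M : D2) : F := alpha * M ord0 ord0 + beta * M ord_max ord_max.

Fact diag_tr_linear : scalar diag_tr.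
Proof. by move=> c M N; rewrite /diag_tr !mxE; ring. Qed.

HB.instance Definition _ := GRing.isLinear.Build F D2 F *%R diag_tr
  diag_tr_linear.

Fact diag_trC (M N : D2) : diag_tr (M * N) = diag_tr (N * M).
Proof.
have valM (P Q : D2) : D2_val (P * Q) = D2_val P *m D2_val Q by [].
have coefM (P Q : D2) i : D2_val (P * Q) i i = P i i * Q i i.
  rewrite valM mxE (bigD1 i) //= big1 ?addr0 // => k ki.
  have := valP P; rewrite inE => /is_diag_mxP -> //; first by rewrite mul0r.
  by rewrite -val_eqE /= eq_sym in ki.
by rewrite /diag_tr !coefM ![M _ _ * _]mulrC.
Qed.

Definition diag_trace : trace D2 := Trace diag_trC.

End DiagonalMatrices.

(* Main.v *)
Require Import Defs.
From HB Require Import structures.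
From mathcomp Require Import all_boot all_order all_algebra.
From mathcomp Require Import finmap monalg ring.

Set Implicit Arguments.
Unset Strict Implicit.
Unset Printing Implicit Defensive.

Import GRing.Theory.

Local Open Scope ring_scope.
Local Open Scope quotient_scope.

(** Write x_i for the diagonal matrix with entries a_i, b_i. Since the trace
    only sees the first entry, the second entry of the value of a monomial
    Tr(u_1) ... Tr(u_k) w is alpha^k times the product of the a_i over all
    letters of u_1 ... u_k times the product of the b_i over the letters of w;
    the first entry is the same expression with b replaced by a. Let
    [ev alpha a b] be the algebra morphism to the field given by the second
    entry. Then f is a trace identity exactly when all [ev alpha a b] kill it
    ([trace_id_vanishing]).

    The common zeros of these evaluations form a trace T-ideal containing f_1
    and f_2, because evaluation turns a substitution x_i -> g_i into a change
    of point: [ev alpha a b (Tr g) = alpha * ev alpha a a g], so the new point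
    is (ev a a g_i, ev a b g_i) ([ev_tsubst], [vanishing_Tideal]).

    Conversely, let I be a trace T-ideal containing f_1 and f_2. Modulo I the
    letters commute, and f_2 splits every trace into traces of letters: with
    y_i = Tr(x_i) / alpha, the trace of a word u is congruent to alpha times
    the product of the y_i over u ([Tideal_Tr_word]). So modulo I every
    element is a combination of commutative monomials in the y_i and the x_i,
    and an evaluation sends y_i to a_i and x_i to b_i. These commutative
    monomials are distinct multiplicative characters of the points (a, b): in
    characteristic 0 a power of 2 recovers each multiplicity. By Dedekind's
    theorem they are linearly independent, so if all evaluations kill f, the
    coefficients of its normal form are 0 and f lies in I
    ([Tideal_vanishing]).

    For the codimension, a multilinear monomial is determined modulo trace
    identities, up to a nonzero scalar, by the set A of letters outside the
    traces. The 2^n products of Tr(x_i) for i not in A and of x_i for i in A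
    therefore span, and by the same character argument they are
    independent. *)

(** * Independence of characters *)

(** Dedekind's argument: combining the relation at [mul x y] with [chi l y] times
    the relation at [x] cancels the term of [l] and multiplies the
    coefficient of [k] by [chi k y - chi l y], which is nonzero for a suitable
    y. Removing the terms other than [k] one at a time leaves [c k = 0]. *)
Lemma dedekind_independence (K : idomainType) (M : Type) (mul : M -> M -> M)
    (e : M) (T : eqType) (chi : T -> M -> K) (s : seq T) :
  (forall k x y, chi k (mul x y) = chi k x * chi k y) ->
  (forall k, chi k e = 1) ->
  {in s &, forall k l, k != l -> exists y, chi k y != chi l y} ->
  uniq s -> forall c : T -> K,
  (forall x, \sum_(k <- s) c k * chi k x = 0) -> {in s, forall k, c k = 0}.
Proof.
move=> chiM chi1 chi_neq uniq_s c sum0 k ks.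
have sum_rem x : \sum_(l <- k :: rem k s) c l * chi l x = 0.
  by rewrite -[RHS](sum0 x); apply: perm_big; rewrite perm_sym perm_to_rem.
have: k \notin rem k s by rewrite mem_rem_uniq // inE eqxx.
have: {subset rem k s <= s} by move=> l /mem_rem.
elim: (rem k s) => [|l r IHr] in c sum_rem {sum0} * => sub_r k_notin.
  by have := sum_rem e; rewrite big_seq1 chi1 mulr1.
move: k_notin; rewrite inE negb_or => /andP[kl k_notin].
have [y chi_y] := chi_neq k l ks (sub_r l (mem_head l r)) kl.
(* The coefficients c i * (chi i y - chi l y) give a relation without l. *)
suff /eqP : c k * (chi k y - chi l y) = 0.
  by rewrite mulf_eq0 subr_eq0 (negPf chi_y) orbF => /eqP.
apply: (IHr (fun i => c i * (chi i y - chi l y))) => // [x|i i_r]; last first.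
  by rewrite sub_r // inE i_r orbT.
transitivity (\sum_(i <- k :: l :: r) c i * chi i (mul x y)
              - chi l y * \sum_(i <- k :: l :: r) c i * chi i x); last first.
  by rewrite !sum_rem mulr0 subr0.
rewrite mulr_sumr -sumrB !big_cons !chiM.
under [in RHS]eq_bigr => i _ do rewrite chiM.
have -> : c l * (chi l x * chi l y) - chi l y * (c l * chi l x) = 0 by ring.
by rewrite add0r; congr (_ + _); [ring | apply: eq_bigr => i _; ring].
Qed.

Lemma sum_by_key (R : pzRingType) (V : lmodType R) (T K : eqType) (s : seq T)
    (key : T -> K) (c : T -> R) (G : K -> V) :
  \sum_(m <- s) c m *: G (key m)
  = \sum_(k <- undup (map key s)) (\sum_(m <- s | key m == k) c m) *: G k.
Proof.
under [RHS]eq_bigr => k _ do rewrite scaler_suml.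
rewrite (exchange_big_dep xpredT) //= big_seq [RHS]big_seq.
apply: eq_bigr => m ms.
rewrite -big_filter (_ : [seq _ <- _ | _] = [:: key m]) ?big_seq1 //.
rewrite (@eq_filter _ _ (pred1 (key m))); last by move=> k; rewrite /= eq_sym.
by rewrite filter_pred1_uniq ?undup_uniq // mem_undup map_f.
Qed.

Lemma eqr_nat_pchar0 (F : fieldType) (m n : nat) : [pchar F] =i pred0 ->
  (m%:R == n%:R :> F) = (m == n).
Proof.
move=> /pcharf0P F0; wlog le_mn : m n / (m <= n)%N.
  by move=> W; have [/W//|/ltnW/W] := leqP m n; rewrite eq_sym [n == m]eq_sym.
by rewrite eq_sym -subr_eq0 -natrB // F0 subn_eq0 eqn_leq le_mn.
Qed.

(** * Congruences modulo an ideal of a noncommutative ring *)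

Section IdealCongruence.

Variables (R : pzRingType) (I : R -> Prop).
Hypothesis I0 : I 0.
Hypothesis ID : forall f g, I f -> I g -> I (f + g).
Hypothesis IM : forall f g h, I f -> I (g * f * h).

Lemma ideal_mull g f : I f -> I (g * f).
Proof. by move=> /(IM g 1); rewrite mulr1. Qed.

Lemma ideal_mulr h f : I f -> I (f * h).
Proof. by move=> /(IM 1 h); rewrite mul1r. Qed.

Lemma ideal_sub_trans g f h : I (f - g) -> I (g - h) -> I (f - h).
Proof. by move=> /ID/[apply]; rewrite addrA subrK. Qed.

Lemma ideal_sub_mul f g f' g' :
  I (f - f') -> I (g - g') -> I (f * g - f' * g').
Proof.
move=> /(ideal_mulr g) If /(ideal_mull f')/(ID If).
by rewrite mulrBl mulrBr addrA subrK.
Qed.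

Lemma ideal_sub_prod (T : Type) (s : seq T) (f g : T -> R) :
  (forall i, I (f i - g i)) -> I (\prod_(i <- s) f i - \prod_(i <- s) g i).
Proof.
move=> fg; elim: s => [|i s IHs]; first by rewrite !big_nil subrr.
by rewrite !big_cons; apply: ideal_sub_mul.
Qed.

Lemma ideal_sum (T : eqType) (s : seq T) (f : T -> R) :
  {in s, forall i, I (f i)} -> I (\sum_(i <- s) f i).
Proof. by move=> If; rewrite big_seq; apply: (big_ind I). Qed.

(** Commutation modulo I of the factors spreads to commutation of a factor with
    a product, then of two products, and every permutation is a composition of
    exchanges of two adjacent blocks. *)
Lemma ideal_sub_prod_perm (T : eqType) (g : T -> R) (s t : seq T) :
  (forall i j, I (g i * g j - g j * g i)) -> perm_eq s t ->
  I (\prod_(i <- s) g i - \prod_(i <- t) g i).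
Proof.
move=> comm_g.
have comm1 i u : I (g i * \prod_(j <- u) g j - (\prod_(j <- u) g j) * g i).
  elim: u => [|j u IHu]; first by rewrite big_nil mulr1 mul1r subrr.
  rewrite big_cons; apply: (@ideal_sub_trans (g j * g i * \prod_(k <- u) g k)).
    by rewrite mulrA -mulrBl; apply: ideal_mulr.
  by rewrite -!mulrA -mulrBr; apply: ideal_mull.
have comm u v : I ((\prod_(j <- u) g j) * (\prod_(j <- v) g j)
                   - (\prod_(j <- v) g j) * \prod_(j <- u) g j).
  elim: u => [|j u IHu]; first by rewrite big_nil mulr1 mul1r subrr.
  rewrite big_cons.
  apply: (@ideal_sub_trans (g j * (\prod_(k <- v) g k) * \prod_(k <- u) g k)).
    by rewrite -!mulrA -mulrBr; apply: ideal_mull.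
  by rewrite [X in _ - X]mulrA -mulrBl; apply: ideal_mulr.
move=> st; pose P u := I (\prod_(i <- s) g i - \prod_(i <- u) g i).
apply: (catCA_perm_ind (P := P) _ st); last by rewrite /P subrr.
move=> u v w /ideal_sub_trans; apply; rewrite !big_cat /= !mulrA -mulrBl.
exact: ideal_mulr.
Qed.

End IdealCongruence.

(** The zero ideal turns the congruence [ideal_sub_prod_perm] into an
    equality; the ring need not be commutative. *)
Lemma prod_perm_comm (R : pzRingType) (T : eqType) (g : T -> R) (s t : seq T) :
  (forall i j, g i * g j = g j * g i) -> perm_eq s t ->
  \prod_(i <- s) g i = \prod_(i <- t) g i.
Proof.
move=> comm_g st; apply/eqP; rewrite -subr_eq0; apply/eqP.
apply: (@ideal_sub_prod_perm R (fun f => f = 0)) => //.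
- by move=> f g' -> ->; rewrite addr0.
- by move=> f g' h ->; rewrite mulr0 mul0r.
by move=> i j; rewrite comm_g subrr.
Qed.

(** * Commutative monomials as characters *)

(** The commutative monomial with trace letters [k.1] and other letters [k.2],
    as a character of the multiplicative monoid of points (a, b). *)
Definition letter_char (R : pzSemiRingType) (k : seq nat * seq nat)
    (p : (nat -> R) * (nat -> R)) : R :=
  (\prod_(i <- k.1) p.1 i) * \prod_(i <- k.2) p.2 i.

(** If the multiplicities of some letter i differ, the point with 2 at i and 1
    elsewhere gives distinct powers of 2; characteristic 0 keeps them
    distinct in the field. *)
Lemma letter_char_sep (F : fieldType) (k l : seq nat * seq nat) :
  [pchar F] =i pred0 -> ~~ (perm_eq k.1 l.1 && perm_eq k.2 l.2) ->
  exists p, letter_char (R := F) k p != letter_char l p.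
Proof.
move=> F0; rewrite negb_and.
pose two (i j : nat) : F := if j == i then 2 else 1.
have prod_two i s : \prod_(j <- s) two i j = (2 ^ count_mem i s)%:R.
  elim: s => [|j s IHs]; first by rewrite big_nil.
  by rewrite big_cons IHs /= expnD natrM /two; case: eqP.
have prod1 (s : seq nat) : \prod_(j <- s) (1 : F) = 1 by rewrite big1.
have two_neq i s t : count_mem i s != count_mem i t ->
    \prod_(j <- s) two i j != \prod_(j <- t) two i j.
  by rewrite !prod_two eqr_nat_pchar0 // eqn_exp2l.
case/orP => /allPn[i _ count_i].
  by exists (two i, fun=> 1); rewrite /letter_char /= !prod1 !mulr1 two_neq.
by exists (fun=> 1, two i); rewrite /letter_char /= !prod1 !mul1r two_neq.
Qed.

Lemma letter_char_independent (F : fieldType) (T : eqType)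
    (key : T -> seq nat * seq nat) (s : seq T) (c : T -> F) :
  [pchar F] =i pred0 ->
  {in s &, forall k l, perm_eq (key k).1 (key l).1 ->
    perm_eq (key k).2 (key l).2 -> k = l} ->
  uniq s -> (forall p, \sum_(k <- s) c k * letter_char (key k) p = 0) ->
  {in s, forall k, c k = 0}.
Proof.
move=> F0 key_inj uniq_s.
pose mul (p q : (nat -> F) * (nat -> F)) :=
  (fun i => p.1 i * q.1 i, fun i => p.2 i * q.2 i).
apply: (@dedekind_independence _ _ mul (fun=> 1, fun=> 1) _
         (fun k => letter_char (key k))) => //.
- by move=> k p q; rewrite /letter_char /= !big_split /=; ring.
- by move=> k; rewrite /letter_char /= !big1 ?mulr1.
move=> k l ks ls kl; apply: letter_char_sep => //.
by apply: contra kl => /andP[/key_inj/[apply] ->].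
Qed.

(** * Monomials, words and traces in the free algebra with trace *)

(** A product of trace indeterminates as a list, each repeated with its
    multiplicity: products over such a list are easier to multiply and permute
    than powers over the support. *)
Definition factors (t : {cmonom cword}) : seq cword :=
  flatten [seq nseq (t c) c | c <- finsupp (cmonom_val t)].

Lemma prod_factors (R : pzSemiRingType) (g : cword -> R) (t : {cmonom cword}) :
  \prod_(c <- finsupp (cmonom_val t)) g c ^+ t c = \prod_(c <- factors t) g c.
Proof.
rewrite /factors big_flatten big_map.
by apply: eq_bigr => c _; rewrite big_nseq iter_mulr_1.
Qed.

Lemma count_factors (t : {cmonom cword}) (c : cword) :
  count_mem c (factors t) = t c.
Proof.
rewrite /factors count_flatten -map_comp sumnE big_map.
under eq_bigr => d _ do rewrite /= count_nseq /=.
have [ct|ct] := boolP (c \in finsupp (cmonom_val t)).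
  rewrite (bigD1_seq c) ?fset_uniq //= eqxx mul1n big1 ?addn0 // => d.
  by move=> /negPf ->.
rewrite big_seq big1 => [|d dt].
  by apply/esym/eqP; rewrite [_ == _]cmE_eq0.
by case: eqP => // dc; rewrite -dc dt in ct.
Qed.

Lemma factorsU (c : cword) : factors (ucm c) = [:: c].
Proof.
apply: perm_small_eq => //; apply/allP => d _ /=.
by rewrite count_factors [ucm _ _]cmU addn0.
Qed.

Lemma factors1 : factors mone = [::].
Proof.
apply: perm_small_eq => //; apply/allP => d _ /=.
by rewrite count_factors [_ d]cm1.
Qed.

Lemma perm_factorsM (t t' : {cmonom cword}) :
  perm_eq (factors (mmul t t')) (factors t ++ factors t').
Proof.
by apply/allP => d _ /=; rewrite count_cat !count_factors [_ d]cmM.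
Qed.

Lemma prod_ucm_factors (t : {cmonom cword}) :
  t = \big[mmul/mone]_(c <- factors t) ucm c.
Proof.
apply/eqP/cmP => d; rewrite -count_factors.
elim: (factors t) => [|c s IHs]; first by rewrite big_nil [RHS]cm1.
by rewrite big_cons [RHS]cmM -IHs [ucm _ _]cmU.
Qed.

(** The representative chosen for a cyclic word is an unknown rotation of the
    original word; two blocks exchanged is the only information needed. *)
Lemma repr_cword (u : nword) : exists v w,
  val u = v ++ w /\ val (repr (\pi_cword u)) = w ++ v.
Proof.
have /eqmodP/rotationP[k ->] : repr (\pi_cword u) = u %[mod cword].
  by rewrite reprK.
by set r := val _; exists (drop k r), (take k r); rewrite cat_take_drop.
Qed.

Section FreeTrace.

Variable F : fieldType.

Lemma ftrU1 (t : {cmonom cword}) (w : {fmonom nat}) (c : F) :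
  << c *g tmon t w >> = c *: << tmon t w >> :> ftr F.
Proof. by apply/malgP => m; rewrite mcoeffZ !mcoeffU mulr_natr. Qed.

Lemma ftrMU (m m' : tmonom) :
  << m >> * << m' >> = << tmmul m m' >> :> ftr F.
Proof. by rewrite [LHS]fgmulUU mulr1. Qed.

Lemma ftr1E : 1 = << tmone >> :> ftr F.
Proof. by []. Qed.

Lemma ftr_wordE (w : seq nat) :
  ftr_word F w = << tmon mone (FMonom w) >>.
Proof.
rewrite /ftr_word; elim: w => [|i w IHw].
  rewrite big_nil ftr1E; congr << tmon _ _ >>.
  by apply: val_inj; rewrite /= fm1.
rewrite big_cons IHw ftrMU; congr << _ >>; rewrite /tmmul /= mul1m.
by congr tmon; apply: val_inj; rewrite /= fmM fmU.
Qed.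

Definition trace_gen (c : cword) : ftr F := << tmon (ucm c) mone >>.

Lemma TrU (m : tmonom) (u : nword) (c : F) : fmonom_val m.2 = val u ->
  Tr << c *g m >>
  = << c *g tmon (mmul m.1 (ucm (\pi_cword u))) mone >> :> ftr F.
Proof.
move=> mu; rewrite /Tr msuppU; case: eqP => [->|_].
  by rewrite big_seq_fset0 monalgU0.
by rewrite big_seq_fset1 mcoeffUU mu valK.
Qed.

Lemma Tr_word (u : nword) : Tr (ftr_word F (val u)) = trace_gen (\pi_cword u).
Proof.
by rewrite ftr_wordE (@TrU _ u) /= ?mul1m.
Qed.

Lemma Tr_wordC (u v : seq nat) :
  Tr (ftr_word F (u ++ v)) = Tr (ftr_word F (v ++ u)).
Proof.
have [uv0|uv0] := eqVneq (u ++ v) [::].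
  by case: u v uv0 => // -[].
have vu0 : v ++ u != [::].
  by rewrite -size_eq0 size_cat addnC -size_cat size_eq0.
rewrite (Tr_word (Sub (u ++ v) uv0)) (Tr_word (Sub (v ++ u) vu0)).
congr trace_gen; apply/eqmodP/rotationP; exists (size u).
by rewrite !SubK rot_size_cat.
Qed.

Lemma trace_genM (c d : cword) :
  trace_gen c * trace_gen d = << tmon (mmul (ucm c) (ucm d)) mone >>.
Proof.
rewrite -[X in tmon _ X](mulm1 mone).
exact: (ftrMU (tmon _ mone) (tmon _ mone)).
Qed.

Lemma trace_genC (c d : cword) :
  trace_gen c * trace_gen d = trace_gen d * trace_gen c.
Proof. by rewrite [LHS]trace_genM [RHS]trace_genM (mulmC (ucm c)). Qed.

Lemma tmonomE (m : tmonom) :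
  << m >>
  = (\prod_(c <- factors m.1) trace_gen c) * ftr_word F (fmonom_val m.2).
Proof.
case: m => t w /=.
have -> : \prod_(c <- factors t) trace_gen c = << tmon t mone >>.
  rewrite {2}[t]prod_ucm_factors.
  elim: (factors t) => [|c s IHs]; first by rewrite !big_nil.
  by rewrite !big_cons IHs ftrMU /tmmul /= mulm1.
rewrite ftr_wordE ftrMU /tmmul /= mulm1 mul1m; congr << tmon _ _ >>.
exact: val_inj.
Qed.

Lemma ftrE (f : ftr F) : f = \sum_(m <- msupp f) f@_m *: << m >>.
Proof.
by rewrite {1}[f]monalgE; apply: eq_bigr => -[t w] _; rewrite -ftrU1.
Qed.

Section Subst.
Variables (B : algType F) (T : B -> B) (a : nat -> B).

Definition tsubst_mon (m : tmonom) : B :=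
  (\prod_(c <- factors m.1) T (\prod_(i <- val (repr c)) a i))
  * \prod_(i <- fmonom_val m.2) a i.

Lemma tsubstE f : tsubst T a f = \sum_(m <- msupp f) f@_m *: tsubst_mon m.
Proof. by apply: eq_bigr => m _; rewrite prod_factors. Qed.

Lemma tsubstEw (d : {fset tmonom}) f : (msupp f `<=` d)%fset ->
  tsubst T a f = \sum_(m <- d) f@_m *: tsubst_mon m.
Proof.
move=> le_d; rewrite tsubstE (big_fset_incl _ le_d) // => m _ /mcoeff_outdom ->.
by rewrite scale0r.
Qed.

Lemma tsubst_linear (c : F) f g :
  tsubst T a (c *: f + g) = c *: tsubst T a f + tsubst T a g.
Proof.
pose d := (msupp f `|` msupp g)%fset.
rewrite !(@tsubstEw d) ?fsubsetUl ?fsubsetUr //.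
  rewrite scaler_sumr -big_split; apply: eq_bigr => m _.
  by rewrite mcoeffD mcoeffZ scalerDl scalerA.
apply: (fsubset_trans (msuppD_le _ _)).
by apply: fsetSU; apply: msuppZ_le.
Qed.

Lemma tsubstB f g : tsubst T a (f - g) = tsubst T a f - tsubst T a g.
Proof.
by rewrite addrC -scaleN1r tsubst_linear scaleN1r addrC.
Qed.

Lemma tsubstU m : tsubst T a << m >> = tsubst_mon m.
Proof. by rewrite tsubstE msuppU1 big_seq_fset1 mcoeffUU scale1r. Qed.

Lemma tsubst_word w : tsubst T a (ftr_word F w) = \prod_(i <- w) a i.
Proof. by rewrite ftr_wordE tsubstU /tsubst_mon factors1 big_nil mul1r. Qed.

End Subst.
End FreeTrace.

(** * Evaluations at pairs of points *)

Section Evaluation.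

Variables (F : fieldType) (alpha : F).

Section Point.
Variables a b : nat -> F.

(** The second diagonal entry of the value of a monomial at the matrices
    diag(a i, b i), for the trace alpha times the first entry. *)
Definition mon_eval (m : tmonom) : F :=
  (\prod_(c <- factors m.1) (alpha * \prod_(i <- val (repr c)) a i))
  * \prod_(i <- fmonom_val m.2) b i.

Fact mon_eval_morphism : mmorphism mon_eval.
Proof.
split=> [m m'|]; rewrite /mon_eval /=; last first.
  by rewrite factors1 fm1 !big_nil mulr1.
rewrite fmM big_cat (perm_big _ (perm_factorsM _ _)) big_cat /=; ring.
Qed.

HB.instance Definition _ := isMultiplicative.Build tmonom F mon_eval
  mon_eval_morphism.

Definition ev (f : ftr F) : F := mmap idfun mon_eval f.

HB.instance Definition _ := GRing.RMorphism.copy ev (mmap idfun mon_eval).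
HB.instance Definition _ := GRing.isScalable.Build F (ftr F) F *%R ev
  (@mmap_is_linear tmonom F mon_eval).

Lemma evD f g : ev (f + g) = ev f + ev g.
Proof. exact: rmorphD. Qed.

Lemma evB f g : ev (f - g) = ev f - ev g.
Proof. exact: rmorphB. Qed.

Lemma evM f g : ev (f * g) = ev f * ev g.
Proof. exact: rmorphM. Qed.

Lemma evZ c f : ev (c *: f) = c * ev f.
Proof. exact: linearZ. Qed.

Lemma evE f : ev f = \sum_(m <- msupp f) f@_m * mon_eval m.
Proof. by []. Qed.

Lemma evU c m : ev << c *g m >> = c * mon_eval m.
Proof. exact: mmapU. Qed.

Lemma ev_var i : ev (ftr_var F i) = b i.
Proof.
by rewrite /ftr_var evU mul1r /mon_eval factors1 big_nil mul1r fmU big_seq1.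
Qed.

Lemma ev_word w : ev (ftr_word F w) = \prod_(i <- w) b i.
Proof. by rewrite rmorph_prod; apply: eq_bigr => i _; rewrite /= ev_var. Qed.

End Point.

(** The trace of a matrix is alpha times its first entry, and the first entry
    is the evaluation at the point (a, a). Without an empty word in [g] the
    junk value of [Tr] is never met. *)
Lemma ev_Tr a b g : no_empty_word g -> ev a b (Tr g) = alpha * ev a a g.
Proof.
move=> g_ne; rewrite rmorph_sum evE mulr_sumr big_seq [RHS]big_seq.
apply: eq_bigr => m /g_ne m_ne; rewrite (insubT (fun s => s != [::]) m_ne) /=.
set u := Sub _ _; rewrite [LHS]evU [RHS]mulrCA; congr (_ * _).
rewrite /mon_eval /=.
rewrite (perm_big _ (perm_factorsM _ _)) big_cat factorsU big_seq1 fm1 big_nil.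
have [v [w [uE ->]]] := repr_cword u.
rewrite (_ : fmonom_val m.2 = val u) // uE !big_cat /=; ring.
Qed.

End Evaluation.

Section NoEmptyWord.
Variable F : fieldType.
Implicit Types f g : ftr F.

Lemma no_empty_wordM f g : no_empty_word f -> no_empty_word (f * g).
Proof.
move=> f_ne m /(fsubsetP (msuppM_incl _ _))/imfset2P[m1 /f_ne m1_ne [m2 _ ->]].
by rewrite fmM; case: fmonom_val m1_ne.
Qed.

Lemma no_empty_word_word w : w != [::] -> no_empty_word (ftr_word F w).
Proof. by move=> w0 m; rewrite ftr_wordE msuppU1 inE => /eqP ->. Qed.

Lemma no_empty_word_prod (s : nat -> ftr F) w : w != [::] ->
  (forall i, no_empty_word (s i)) -> no_empty_word (\prod_(i <- w) s i).
Proof.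
by case: w => // i w _ s_ne; rewrite big_cons; apply: no_empty_wordM.
Qed.

End NoEmptyWord.

(** Inside a trace the substituted elements are evaluated at (a, a), outside
    at (a, b), by [ev_Tr]. *)
Lemma ev_tsubst (F : fieldType) (alpha : F) a b (s : nat -> ftr F) f :
  (forall i, no_empty_word (s i)) ->
  ev alpha a b (tsubst (@Tr F) s f)
  = ev alpha (fun i => ev alpha a a (s i)) (fun i => ev alpha a b (s i)) f.
Proof.
move=> s_ne; rewrite tsubstE rmorph_sum evE; apply: eq_bigr => m _ /=.
rewrite evZ rmorphM !rmorph_prod; congr (_ * (_ * _)); apply: eq_bigr => c _.
rewrite /= ev_Tr ?rmorph_prod //.
exact: (no_empty_word_prod (valP (repr c))).
Qed.

Definition vanishing (F : fieldType) (alpha : F) (f : ftr F) : Prop :=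
  forall a b, ev alpha a b f = 0.

Lemma vanishing_Tideal (F : fieldType) (alpha : F) :
  trace_Tideal (vanishing alpha).
Proof.
split=> [a b|f g f0 g0 a b|f g h f0 a b|s f s_ne f0 a b].
- exact: rmorph0.
- by rewrite rmorphD /= f0 g0 addr0.
- by rewrite !rmorphM /= f0 mulr0 mul0r.
- by rewrite ev_tsubst.
Qed.

Lemma ftr_word1 (F : fieldType) i : ftr_word F [:: i] = ftr_var F i.
Proof. exact: big_seq1. Qed.

Lemma ftr_word2 (F : fieldType) i j :
  ftr_word F [:: i; j] = ftr_var F i * ftr_var F j.
Proof. by rewrite /ftr_word big_cons big_seq1. Qed.

Lemma no_empty_word_var (F : fieldType) i : no_empty_word (ftr_var F i).
Proof. by rewrite -ftr_word1; apply: no_empty_word_word. Qed.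

Lemma vanishing_f1 (F : fieldType) (alpha : F) : vanishing alpha (f1 F).
Proof.
move=> a b; rewrite /f1 evB; apply/eqP; rewrite subr_eq0; apply/eqP.
rewrite [LHS]evM [RHS]evM; exact: mulrC.
Qed.

Lemma vanishing_f2 (F : fieldType) (alpha : F) : vanishing alpha (f2 alpha).
Proof.
have ne i := @no_empty_word_var F i.
move=> a b; rewrite /f2 evB evZ; apply/eqP; rewrite subr_eq0; apply/eqP.
transitivity ((alpha * ev alpha a a (ftr_var F 0))
              * (alpha * ev alpha a a (ftr_var F 1))).
  by rewrite [LHS]evM; congr (_ * _); apply: ev_Tr.
transitivity (alpha * (alpha * (ev alpha a a (ftr_var F 0)
                                * ev alpha a a (ftr_var F 1)))).
  by rewrite -!mulrA; congr (_ * _); apply: mulrCA.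
congr (_ * _); rewrite [RHS]ev_Tr; last exact: no_empty_wordM.
by congr (_ * _); rewrite [RHS]evM.
Qed.

(** All letters that occur inside traces: the only information on the traces,
    besides their number, that survives modulo f_1 and f_2. *)
Definition trace_letters (t : {cmonom cword}) : seq nat :=
  flatten [seq val (repr c) | c <- factors t].

Lemma prod_trace_letters (R : pzSemiRingType) (g : nat -> R) t :
  \prod_(i <- trace_letters t) g i
  = \prod_(c <- factors t) \prod_(i <- val (repr c)) g i.
Proof. by rewrite [LHS]big_flatten big_map. Qed.

Lemma mon_evalE (F : fieldType) (alpha : F) a b m :
  mon_eval alpha a b m = alpha ^+ size (factors m.1)
    * letter_char (trace_letters m.1, fmonom_val m.2) (a, b).
Proof.
rewrite /mon_eval big_split /= /letter_char mulrA; congr (_ * _ * _).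
  by rewrite big_const_seq count_predT iter_mulr_1.
by rewrite prod_trace_letters.
Qed.

(** * Normal forms modulo a trace T-ideal containing f_1 and f_2 *)

Section Reduction.

Variables (F : fieldType) (alpha : F) (alpha_neq0 : alpha != 0).
Variable I : ftr F -> Prop.
Hypotheses (I_ideal : trace_Tideal I) (I_f1 : I (f1 F)) (I_f2 : I (f2 alpha)).

Let I0 : I 0. Proof. by case: I_ideal. Qed.
Let ID f g : I f -> I g -> I (f + g).
Proof. by case: I_ideal => _ + _ _; apply. Qed.
Let IM f g h : I f -> I (g * f * h).
Proof. by case: I_ideal => _ _ + _; apply. Qed.

Let IZ c f : I f -> I (c *: f).
Proof. by move=> /(@IM f c%:A 1); rewrite mulr1 -scalerAl mul1r. Qed.

Let substI (s : nat -> ftr F) f : (forall i, no_empty_word (s i)) ->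
  I f -> I (tsubst (@Tr F) s f).
Proof. by case: I_ideal => _ _ _; apply. Qed.

Lemma Tideal_varC i j :
  I (ftr_var F i * ftr_var F j - ftr_var F j * ftr_var F i).
Proof.
pose s k := ftr_var F (if k == 0%N then i else j).
have f1E : f1 F = ftr_word F [:: 0%N; 1%N] - ftr_word F [:: 1%N; 0%N].
  by rewrite [X in X - _]ftr_word2 [X in _ - X]ftr_word2.
suff <- : tsubst (@Tr F) s (f1 F)
    = ftr_var F i * ftr_var F j - ftr_var F j * ftr_var F i.
  by apply: substI => // k; apply: no_empty_word_var.
have tsubst2 k l : tsubst (@Tr F) s (ftr_word F [:: k; l]) = s k * s l.
  by rewrite tsubst_word big_cons big_seq1.
rewrite f1E.
apply: (etrans (tsubstB (@Tr F) s _ _)).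
exact: (congr2 (fun x y => x - y) (tsubst2 0%N 1%N) (tsubst2 1%N 0%N)).
Qed.

Lemma Tr_wordMC u v : u != [::] -> v != [::] ->
  Tr (ftr_word F u) * Tr (ftr_word F v) = Tr (ftr_word F v) * Tr (ftr_word F u).
Proof.
move=> u_ne v_ne; rewrite (Tr_word F (Sub u u_ne)) (Tr_word F (Sub v v_ne)).
exact: trace_genC.
Qed.

Section WordSubstitution.
Variable s : nat -> seq nat.
Hypothesis s_ne : forall i, s i != [::].

Let sub : ftr F -> ftr F := tsubst (@Tr F) (ftr_word F \o s).
Let image_trace (c : cword) : ftr F :=
  Tr (ftr_word F (flatten [seq s i | i <- val (repr c)])).

Lemma flatten_word_neq0 w : w != [::] -> flatten [seq s i | i <- w] != [::].
Proof. by case: w => // i w _ /=; case: (s i) (s_ne i). Qed.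

Lemma tsubst_tmonom t w : sub << tmon t w >>
  = (\prod_(c <- factors t) image_trace c)
    * \prod_(i <- fmonom_val w) ftr_word F (s i).
Proof.
rewrite /sub tsubstU /tsubst_mon; apply: congr2 => //; apply: eq_bigr => c _.
by rewrite /image_trace /ftr_word big_flatten big_map.
Qed.

Lemma tsubst_trace_gen c : sub (trace_gen F c) = image_trace c.
Proof. by rewrite [LHS]tsubst_tmonom factorsU big_seq1 fm1 big_nil mulr1. Qed.

(** The values of the two traces commute, so the unknown order in which
    [factors] lists the two indeterminates does not matter. *)
Lemma tsubst_trace_genM c d :
  sub (trace_gen F c * trace_gen F d) = image_trace c * image_trace d.
Proof.
rewrite trace_genM [LHS]tsubst_tmonom fm1 big_nil mulr1.
rewrite (prod_perm_comm _ (perm_factorsM _ _)) => [|{}c {}d].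
  by rewrite !factorsU /= big_cons big_seq1.
apply: Tr_wordMC; apply: flatten_word_neq0; first exact: (valP (repr c)).
exact: (valP (repr d)).
Qed.

Lemma tsubst_Tr_word w : w != [::] ->
  sub (Tr (ftr_word F w)) = Tr (ftr_word F (flatten [seq s i | i <- w])).
Proof.
move=> w_ne; rewrite (Tr_word F (Sub w w_ne)) tsubst_trace_gen /image_trace.
have [u [v [/= wE ->]]] := repr_cword (Sub w w_ne).
by rewrite [in RHS]wE !map_cat !flatten_cat Tr_wordC.
Qed.

Lemma tsubst_Tr_wordM w x : w != [::] -> x != [::] ->
  sub (Tr (ftr_word F w) * Tr (ftr_word F x))
  = Tr (ftr_word F (flatten [seq s i | i <- w]))
    * Tr (ftr_word F (flatten [seq s i | i <- x])).
Proof.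
move=> w_ne x_ne; rewrite -(tsubst_Tr_word w_ne) -(tsubst_Tr_word x_ne).
rewrite (Tr_word F (Sub w w_ne)) (Tr_word F (Sub x x_ne)).
rewrite [LHS]tsubst_trace_genM.
by apply: congr2; rewrite [RHS]tsubst_trace_gen.
Qed.

End WordSubstitution.

(** The substitution x_1 -> u, x_2 -> v in f_2; words suffice, since every
    trace indeterminate is the trace of a word. *)
Lemma Tideal_TrM u v : u != [::] -> v != [::] ->
  I (Tr (ftr_word F u) * Tr (ftr_word F v) - alpha *: Tr (ftr_word F (u ++ v))).
Proof.
move=> u_ne v_ne; pose s k := if k == 0%N then u else v.
have s_ne k : s k != [::] by rewrite /s; case: ifP.
suff <- : tsubst (@Tr F) (ftr_word F \o s) (f2 alpha)
    = Tr (ftr_word F u) * Tr (ftr_word F v) - alpha *: Tr (ftr_word F (u ++ v)).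
  by apply: substI => // k; apply: no_empty_word_word.
have f2E : f2 alpha = - alpha *: Tr (ftr_word F [:: 0%N; 1%N])
    + Tr (ftr_word F [:: 0%N]) * Tr (ftr_word F [:: 1%N]).
  by rewrite [RHS]addrC scaleNr !ftr_word1 ftr_word2.
rewrite f2E; apply: (etrans (tsubst_linear (@Tr F) _ _ _ _)).
have := @tsubst_Tr_wordM s s_ne [:: 0%N] [:: 1%N] isT isT.
have := @tsubst_Tr_word s [:: 0%N; 1%N] isT.
rewrite /= !cats0 => E1 E2; rewrite scaleNr addrC.
exact: (congr2 (fun x y => x - alpha *: y) E2 E1).
Qed.

(** Normalized so that every evaluation at (a, b) sends it to [a i], without
    a power of alpha. *)
Definition trace_var i : ftr F := alpha^-1 *: Tr (ftr_var F i).

Definition normal_form (k : seq nat * seq nat) : ftr F :=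
  (\prod_(i <- k.1) trace_var i) * ftr_word F k.2.

(** Peeling off the letters one by one with f_2. In particular Tr(u[v,w]) lies
    in I although a trace T-ideal need not be closed under [Tr]; this is
    where alpha must be invertible. *)
Lemma Tideal_Tr_word u : u != [::] ->
  I (Tr (ftr_word F u) - alpha *: \prod_(i <- u) trace_var i).
Proof.
elim: u => [|i u IHu _]; first discriminate.
rewrite big_cons; have [->|u_ne] := eqVneq u [::].
  rewrite big_nil mulr1 ftr_word1 /trace_var.
  by rewrite scalerA (mulfV alpha_neq0) scale1r subrr.
apply: (ideal_sub_trans ID (g := trace_var i * Tr (ftr_word F u))); last first.
  rewrite scalerAr -mulrBr; apply: (ideal_mull IM); exact: IHu.
(* Up to the factor - alpha^-1, this is f_2 at the words x_i and u. *)
have := IZ (- alpha^-1) (@Tideal_TrM [:: i] u isT u_ne).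
rewrite scalerBr !scaleNr scalerA (mulVf alpha_neq0) scale1r opprK ftr_word1.
by rewrite -scalerAl addrC.
Qed.

Lemma trace_varC i j : trace_var i * trace_var j = trace_var j * trace_var i.
Proof.
have E k l : trace_var k * trace_var l
    = alpha^-1 *: (alpha^-1
        *: (Tr (ftr_word F [:: k]) * Tr (ftr_word F [:: l]))).
  by rewrite !ftr_word1 -scalerAl -scalerAr.
by rewrite [LHS]E [RHS]E (@Tr_wordMC [:: i] [:: j]).
Qed.

Lemma Tideal_sub_normal_form_perm k l :
  perm_eq k.1 l.1 -> perm_eq k.2 l.2 -> I (normal_form k - normal_form l).
Proof.
move=> kl1 kl2; apply: (ideal_sub_mul ID IM); last first.
  exact: (ideal_sub_prod_perm I0 ID IM Tideal_varC).
apply: (ideal_sub_prod_perm I0 ID IM _ kl1) => i j.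
by have /eqP := trace_varC i j; rewrite -subr_eq0 => /eqP ->.
Qed.

Lemma Tideal_sub_normal_form m :
  I (<< m >> - alpha ^+ size (factors m.1)
               *: normal_form (trace_letters m.1, fmonom_val m.2)).
Proof.
rewrite tmonomE /normal_form scalerAl /=.
apply: (ideal_sub_mul ID IM); last by rewrite subrr.
rewrite prod_trace_letters.
have -> : alpha ^+ size (factors m.1)
      *: \prod_(c <- factors m.1) \prod_(i <- val (repr c)) trace_var i
    = \prod_(c <- factors m.1) (alpha *: \prod_(i <- val (repr c)) trace_var i).
  by rewrite scaler_prod big_const_seq count_predT iter_mulr_1.
apply: (ideal_sub_prod I0 ID IM) => c.
have -> : trace_gen F c = Tr (ftr_word F (val (repr c))).
  by rewrite Tr_word reprK.
exact: Tideal_Tr_word (valP (repr c)).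
Qed.

(** Monomials are grouped by their sorted lists of letters. The sum of the
    coefficients over each group is a coefficient in a vanishing combination of
    distinct characters, hence is 0; modulo I the group itself is this sum
    times one normal form. *)
Lemma Tideal_vanishing : [pchar F] =i pred0 ->
  forall f, vanishing alpha f -> I f.
Proof.
move=> F0 f f_van.
pose key (m : tmonom) :=
  (sort leq (trace_letters m.1), sort leq (fmonom_val m.2)).
pose c (m : tmonom) := f@_m * alpha ^+ size (factors m.1).
have key_perm m : perm_eq (trace_letters m.1) (key m).1
    /\ perm_eq (fmonom_val m.2) (key m).2.
  by split; rewrite perm_sym perm_sort.
have coef0 : {in undup [seq key m | m <- msupp f],
    forall k, \sum_(m <- msupp f | key m == k) c m = 0}.
  apply: (letter_char_independent (key := id)) => //.
  - move=> k l; rewrite !mem_undup => /mapP[m _ ->] /mapP[m' _ ->].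
    move=> /= p1 p2; congr pair; apply: (sorted_eq leq_trans anti_leq);
      by rewrite ?sort_sorted //; apply: leq_total.
  - exact: undup_uniq.
  move=> [a b]; rewrite -[RHS](f_van a b) evE.
  (* F as a module over itself: the same grouping applies to the values. *)
  have := sum_by_key (msupp f) key c (fun k => letter_char k (a, b) : F^o).
  move=> <-; apply: eq_bigr => m _.
  have [p1 p2] := key_perm m.
  by rewrite mon_evalE mulrA /letter_char (perm_big _ p1) (perm_big _ p2).
suff: I (f - \sum_(m <- msupp f) c m *: normal_form (key m)).
  rewrite sum_by_key big_seq big1 => [|k /coef0 ->]; first by rewrite subr0.
  exact: scale0r.
rewrite {1}[f]ftrE -sumrB; apply: (ideal_sum I0 ID) => m _.
rewrite -scalerA -scalerBr; apply: IZ.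
apply: (ideal_sub_trans ID (Tideal_sub_normal_form m)).
have [p1 p2] := key_perm m.
by rewrite -scalerBr; apply/IZ/Tideal_sub_normal_form_perm.
Qed.

End Reduction.

(** * Trace identities of diagonal matrices as vanishing evaluations *)

Section DiagonalEntries.

Variable F : fieldType.

(** On diagonal matrices the diagonal entries are algebra morphisms, so an
    identity in [D2] can be read off entry by entry. *)
Definition entry (j : 'I_2) (M : D2 F) : F := D2_val M j j.

Fact entry_linear j : scalar (entry j).
Proof. by move=> c M N; rewrite /entry !mxE. Qed.

HB.instance Definition _ j := GRing.isLinear.Build F (D2 F) F *%R (entry j)
  (entry_linear j).

Fact entry_monoid_morphism j : monoid_morphism (entry j).
Proof.
split=> [|M N]; first by rewrite /entry mxE eqxx.
rewrite /entry [LHS]mxE (bigD1 j) //= big1 ?addr0 // => k kj.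
have := valP M; rewrite inE => /is_diag_mxP -> //; first by rewrite mul0r.
by rewrite eq_sym.
Qed.

HB.instance Definition _ j := GRing.isMonoidMorphism.Build (D2 F) F (entry j)
  (entry_monoid_morphism j).

Lemma entry_scalar j (c : F) : entry j c%:A = c.
Proof. by rewrite linearZ /= rmorph1 mulr1. Qed.

Lemma entryP (M N : D2 F) : (forall j, entry j M = entry j N) -> M = N.
Proof.
move=> MN; apply/val_inj/matrixP => i j /=.
have [<-|ij] := eqVneq i j; first exact: MN.
have /is_diag_mxP -> // := valP M; by have /is_diag_mxP -> := valP N.
Qed.

Definition D2_diag (x y : F) : D2 F :=
  MkD2 (diag_mx_is_diag (\row_j if j == ord0 then x else y)).

Lemma entry_diag x y j : entry j (D2_diag x y) = if j == ord0 then x else y.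
Proof. by rewrite /entry /= !mxE eqxx. Qed.

Variable alpha : F.

Lemma entry_tsubst (a : nat -> D2 F) f j :
  entry j (tsubst (fun b => (diag_trace alpha 0 b)%:A) a f)
  = ev alpha (fun i => entry ord0 (a i)) (fun i => entry j (a i)) f.
Proof.
rewrite tsubstE linear_sum evE; apply: eq_bigr => m _ /=.
rewrite linearZ /= rmorphM !rmorph_prod; congr (_ * (_ * _)).
apply: eq_bigr => c _; rewrite -rmorph_prod.
by rewrite [LHS]entry_scalar /= /diag_tr mul0r addr0.
Qed.

(** The first entry of a value is again an evaluation, at (a, a), so the second
    entries at all points decide. *)
Lemma trace_id_vanishing f :
  trace_id (diag_trace alpha 0) f <-> vanishing alpha f.
Proof.
split=> [f0 a b|f0 a].
  have := congr1 (entry ord_max) (f0 (fun i => D2_diag (a i) (b i))).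
  rewrite entry_tsubst rmorph0 => <-.
  apply: eq_bigr => m _; congr (_ * (_ * _)); last first.
    by apply: eq_bigr => i _; rewrite entry_diag.
  apply: eq_bigr => c _; congr (_ * _).
  by apply: eq_bigr => i _; rewrite entry_diag.
by apply: entryP => j; rewrite entry_tsubst rmorph0 f0.
Qed.

End DiagonalEntries.

(** * Multilinear elements and the codimension *)

Section LinearSpan.
Variables (F : fieldType) (V : lmodType F) (S : V -> Prop).

Lemma lspan_gen v : S v -> lspan S v.
Proof.
move=> Sv; exists [:: (1, v)]; last by rewrite big_seq1 scale1r.
by move=> p; rewrite inE => /eqP ->.
Qed.

Lemma lspan0 : lspan S 0.
Proof. by exists [::] => //; rewrite big_nil. Qed.

Lemma lspanD u v : lspan S u -> lspan S v -> lspan S (u + v).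
Proof.
move=> [s Ss ->] [t St ->]; exists (s ++ t); last by rewrite big_cat.
by move=> p; rewrite mem_cat => /orP[/Ss|/St].
Qed.

Lemma lspanZ c v : lspan S v -> lspan S (c *: v).
Proof.
move=> [s Ss ->]; exists [seq (c * p.1, p.2) | p <- s].
  by move=> _ /mapP[p ps ->]; apply: (Ss p).
by rewrite big_map scaler_sumr; apply: eq_bigr => p _; rewrite scalerA.
Qed.

Lemma lspanB u v : lspan S u -> lspan S v -> lspan S (u - v).
Proof. by move=> Su Sv; rewrite -scaleN1r; apply/lspanD/lspanZ. Qed.

Lemma lspan_comb (T : Type) (s : seq T) (c : T -> F) (b : T -> V) :
  (forall i, lspan S (b i)) -> lspan S (\sum_(i <- s) c i *: b i).
Proof.
move=> Sb; apply: (big_ind (lspan S)) => [|u v|i _].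
- exact: lspan0.
- exact: lspanD.
- exact/lspanZ.
Qed.

End LinearSpan.

Section VanishingSpace.
Variables (F : fieldType) (alpha : F).

Lemma vanishingB_eq (f g : ftr F) :
  vanishing alpha (f - g) <-> forall a b, ev alpha a b f = ev alpha a b g.
Proof.
split=> fg a b; last by rewrite evB fg subrr.
by apply/eqP; rewrite -subr_eq0 -evB fg.
Qed.

Lemma ev_comb a b (T : Type) (s : seq T) (c : T -> F) (f : T -> ftr F) :
  ev alpha a b (\sum_(i <- s) c i *: f i)
  = \sum_(i <- s) c i * ev alpha a b (f i).
Proof.
elim: s => [|i s IHs]; first by rewrite !big_nil; apply: rmorph0.
by rewrite !big_cons -IHs -evZ; apply: evD.
Qed.

End VanishingSpace.

Section Codimension.

Variables (F : fieldType) (alpha : F) (alpha_neq0 : alpha != 0).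

Definition trace_monomial (us : seq (seq nat)) (w : seq nat) : ftr F :=
  (\prod_(u <- us) Tr (ftr_word F u)) * ftr_word F w.

Lemma ev_trace_monomial a b us w : [::] \notin us ->
  ev alpha a b (trace_monomial us w)
  = alpha ^+ size us * letter_char (flatten us, w) (a, b).
Proof.
move=> us_ne; rewrite evM ev_word /letter_char /= mulrA; congr (_ * _).
rewrite rmorph_prod big_flatten -iter_mulr_1 -count_predT -big_const_seq.
rewrite -big_split big_seq [RHS]big_seq; apply: eq_bigr => u u_us /=.
rewrite ev_Tr ?ev_word //; apply: no_empty_word_word.
by apply: contraNneq us_ne => <-.
Qed.

Variable n : nat.
Implicit Types A B : {set 'I_n}.

Definition letters A : seq nat := [seq val i | i <- enum A].

Lemma mem_letters A (i : 'I_n) : (val i \in letters A) = (i \in A).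
Proof. by rewrite (mem_map val_inj) mem_enum. Qed.

Lemma letters_uniq A : uniq (letters A).
Proof. by rewrite (map_inj_uniq val_inj) enum_uniq. Qed.

Lemma letters_inj A B : perm_eq (letters A) (letters B) -> A = B.
Proof.
by move=> /perm_mem AB; apply/setP => i; rewrite -!mem_letters AB.
Qed.

Lemma perm_letters A s : uniq s -> {in s, forall x, (x < n)%N} ->
  (forall i : 'I_n, (val i \in s) = (i \in A)) -> perm_eq s (letters A).
Proof.
move=> uniq_s s_lt sA; apply: uniq_perm => //; first exact: letters_uniq.
move=> x; apply/idP/idP => [xs|/mapP[i + ->]]; last by rewrite mem_enum -sA.
by rewrite -[x]/(val (Ordinal (s_lt x xs))) mem_letters -sA.
Qed.

Definition subset_monomial A : ftr F :=
  trace_monomial [seq [:: i] | i <- letters (~: A)] (letters A).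

Lemma ev_subset_monomial a b A : ev alpha a b (subset_monomial A)
  = alpha ^+ #|~: A| * letter_char (letters (~: A), letters A) (a, b).
Proof.
rewrite ev_trace_monomial ?flatten_seq1 ?size_map -?cardE //.
by apply/negP => /mapP[].
Qed.

Lemma subset_monomial_multilinear A :
  multilinear_monomial n (subset_monomial A).
Proof.
exists [seq [:: i] | i <- letters (~: A)], (letters A); split=> //.
  by apply/negP => /mapP[].
rewrite flatten_seq1 -map_cat -val_enum_ord; apply/perm_map/uniq_perm.
- rewrite cat_uniq !enum_uniq andbT; apply/hasPn => i.
  by rewrite !mem_enum inE negbK.
- exact: enum_uniq.
by move=> i; rewrite mem_cat !mem_enum !inE orNb.
Qed.

(** Both sides have the same letters inside and outside traces, so their
    evaluations differ only by the numbers of traces, that is by a power of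
    alpha. *)
Lemma multilinear_subset_monomial f : multilinear_monomial n f ->
  exists A, exists c, vanishing alpha (f - c *: subset_monomial A).
Proof.
move=> [us [w [us_ne perm_usw ->]]].
have uniq_usw : uniq (flatten us ++ w).
  by rewrite (perm_uniq perm_usw) iota_uniq.
have mem_usw x : (x \in flatten us) || (x \in w) = (x < n)%N.
  by rewrite -mem_cat (perm_mem perm_usw) mem_iota add0n.
move: uniq_usw; rewrite cat_uniq => /and3P[uniq_us disj uniq_w].
pose A := [set i : 'I_n | val i \in w].
have perm_w : perm_eq w (letters A).
  apply: perm_letters => // [x xw|i]; last by rewrite inE.
  by rewrite -mem_usw xw orbT.
have perm_us : perm_eq (flatten us) (letters (~: A)).
  apply: perm_letters => // [x xus|i]; first by rewrite -mem_usw xus.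
  rewrite !inE; have := mem_usw (val i); rewrite ltn_ord.
  case: (boolP (val i \in w)) => [iw _|_]; last by rewrite orbF.
  by apply: contraNF disj => ius; apply/hasP; exists (val i).
exists A, (alpha ^+ size us / alpha ^+ #|~: A|); apply/vanishingB_eq => a b.
rewrite [RHS]evZ [X in _ = _ * X]ev_subset_monomial mulrA.
rewrite divfK; last exact: expf_neq0.
rewrite [LHS](ev_trace_monomial _ _ _ us_ne).
by rewrite /letter_char /= (perm_big _ perm_us) (perm_big _ perm_w).
Qed.

Lemma subset_monomials_independent (c : {set 'I_n} -> F) :
  [pchar F] =i pred0 ->
  vanishing alpha (\sum_(A : {set 'I_n}) c A *: subset_monomial A) ->
  forall A, c A = 0.
Proof.
move=> F0 c_van A.
suff /(_ A (mem_index_enum A))/eqP : {in index_enum {set 'I_n},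
    forall B, c B * alpha ^+ #|~: B| = 0}.
  by rewrite mulf_eq0 expf_eq0 (negPf alpha_neq0) andbF orbF => /eqP.
pose key B := (letters (~: B), letters B).
apply: (letter_char_independent (key := key)) => //.
- by move=> B C _ _ _; apply: letters_inj.
- exact: index_enum_uniq.
move=> [a b]; rewrite -[RHS](c_van a b) ev_comb; apply: eq_bigr => B _.
by rewrite ev_subset_monomial mulrA.
Qed.

Lemma MT_span_subset_monomials f : MT n f ->
  exists c : {set 'I_n} -> F,
    vanishing alpha (f - \sum_(A : {set 'I_n}) c A *: subset_monomial A).
Proof.
move=> [s s_mon ->].
elim: s s_mon => [|[d p] s IHs] s_mon.
  exists (fun=> 0); apply/vanishingB_eq => a b.
  by rewrite big_nil big1 // => A _; rewrite scale0r.
have [c c_van] := IHs (fun q qs => s_mon q (@mem_behead _ (_ :: s) q qs)).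
have [B [e e_van]] := multilinear_subset_monomial (s_mon (d, p) (mem_head _ _)).
exists (fun A => (if A == B then d * e else 0) + c A).
move/vanishingB_eq in c_van; move/vanishingB_eq in e_van.
apply/vanishingB_eq => a b; rewrite big_cons.
transitivity (d * (e * ev alpha a b (subset_monomial B))
              + \sum_A c A * ev alpha a b (subset_monomial A)).
  apply: (etrans (evD _ _ _ _ _)); apply: congr2.
    by apply: (etrans (evZ _ _ _ _ _)); rewrite e_van evZ.
  by apply: (etrans (c_van a b)); apply: ev_comb.
rewrite [RHS]ev_comb; under [RHS]eq_bigr => A _ do rewrite mulrDl.
rewrite big_split /=; congr (_ + _); rewrite (bigD1 B) //= eqxx big1 => [|A].
  by rewrite addr0 mulrA.
by move=> /negPf ->; apply: mul0r.
Qed.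

End Codimension.

(** A basis indexed by any finite type of the right cardinality, here the
    subsets of the letters, can be renumbered. *)
Lemma quotient_dim_fin (F : fieldType) (V : lmodType F) (U W : V -> Prop)
    (T : finType) (b : T -> V) (d : nat) : #|T| = d ->
  (forall i, U (b i)) ->
  (forall c : T -> F, W (\sum_i c i *: b i) -> forall i, c i = 0) ->
  (forall v, U v -> exists c : T -> F, W (v - \sum_i c i *: b i)) ->
  quotient_dim U W d.
Proof.
move=> <- Ub indep gen; exists (b \o enum_val); split=> [i|c Wc i|v].
- exact: Ub.
- rewrite -[i]enum_valK; apply: (indep (c \o enum_rank)).
  rewrite (reindex (enum_val (A := T))) /=; last by apply/onW_bij/enum_val_bij.
  by under eq_bigr => j _ do rewrite enum_valK.
move=> /gen[c Wc]; exists (c \o enum_val).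
rewrite (reindex (enum_val (A := T))) /= in Wc; first exact: Wc.
by apply/onW_bij/enum_val_bij.
Qed.

Theorem theorem8 (F : fieldType) (char0 : [pchar F] =i pred0)
    (alpha : F) (alpha_neq0 : alpha != 0) :
  (forall f : ftr F,
     trace_id (diag_trace alpha 0) f <->
     generated_Tideal (fun g => g = f1 F \/ g = f2 alpha) f)
  /\ (forall n : nat, (0 < n)%N ->
        trace_codim (diag_trace alpha 0) n (2 ^ n)%N).
Proof.
split=> [f|n _].
  split=> [/trace_id_vanishing f_van I I_ideal gens|f_gen].
    apply: (Tideal_vanishing alpha_neq0) f_van => //.
      by apply: gens; left.
    by apply: gens; right.
  apply/trace_id_vanishing; apply: f_gen; first exact: vanishing_Tideal.
  by move=> g [->|->]; [apply: vanishing_f1 | apply: vanishing_f2].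
have MT_subset A : MT n (@subset_monomial F n A).
  exact/lspan_gen/subset_monomial_multilinear.
apply: (@quotient_dim_fin _ _ _ _ {set 'I_n} (@subset_monomial F n)) => //.
- by rewrite -cardsT -powersetT card_powerset cardsT card_ord.
- move=> c [_ /trace_id_vanishing]; exact: subset_monomials_independent.
move=> f f_MT; have [c c_van] := MT_span_subset_monomials alpha_neq0 f_MT.
exists c; split; last exact/trace_id_vanishing.
by apply: lspanB => //; apply: lspan_comb.
Qed.
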